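(* Let $\mathcal L_{\mathrm{LE}}$ be any LE-language and let $\mathbb A$ be a perfect $\mathcal L_{\mathrm{LE}}$-algebra. If ALBA succeeds in reducing an $\mathcal L_{\mathrm{LE}}$-inequality $\phi\le\psi$ and yields the output $\mathsf{ALBA}(\phi\le\psi)$ (a finite conjunction of pure quasi-inequalities), then $\mathbb A\models\phi\le\psi$ if and only if $\mathbb A\models\mathsf{ALBA}(\phi\le\psi)$.
   Context: **Languages and algebras.** An order-type over $n$ is a tuple $\varepsilon\in\{1,\partial\}^n$; $1^\partial=\partial$, $\partial^\partial=1$. An LE-language $\mathcal L_{\mathrm{LE}}$ is given by a denumerable set $\mathsf{PROP}$ of propositional variables and disjoint sets $\mathcal F,\mathcal G$ of connectives, each $h\in\mathcal F\cup\mathcal G$ having an arity $n_h$ and an order-type $\varepsilon_h$ over $n_h$. Terms: $\phi::=p\mid\bot\mid\top\mid\phi\wedge\phi\mid\phi\vee\phi\mid f(\overline\phi)\mid g(\overline\phi)$. An $\mathcal L_{\mathrm{LE}}$-algebra (normal lattice expansion, LE) is a bounded lattice with an $n_h$-ary operation for each $h\in\mathcal F\cup\mathcal G$ such that: each $f\in\mathcal F$ preserves finite (including empty) joins in each coordinate $i$ with $\varepsilon_f(i)=1$ and sends finite (including empty) meets to joins in each coordinate with $\varepsilon_f(i)=\partial$; each $g\in\mathcal G$ preserves finite (including empty) meets in each coordinate with $\varepsilon_g(i)=1$ and sends finite (including empty) joins to meets in each coordinate with $\varepsilon_g(i)=\partial$. **Perfect LEs.** A lattice is perfect if it is complete, every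 element is a join of completely join-irreducible elements, and every element is a meet of completely meet-irreducible elements ($J^\infty(\mathbb A)$ and $M^\infty(\mathbb A)$ denote the sets of these). An LE is perfect if its lattice is perfect and the coordinatewise preservation laws above hold for arbitrary joins and meets. **Expanded language.** $\mathcal F^*\supseteq\mathcal F$ and $\mathcal G^*\supseteq\mathcal G$ are obtained by adding, for $f\in\mathcal F$ and $1\le i\le n_f$, an $n_f$-ary connective $f_i^\sharp$ (in $\mathcal G^*$ if $\varepsilon_f(i)=1$, in $\mathcal F^*$ if $\varepsilon_f(i)=\partial$) and, for $g\in\mathcal G$ and $1\le i\le n_g$, an $n_g$-ary connective $g_i^\flat$ (in $\mathcal F^*$ if $\varepsilon_g(i)=1$, in $\mathcal G^*$ if $\varepsilon_g(i)=\partial$). Order-types: for $k=h_i^\sharp$ or $k=h_i^\flat$, if $\varepsilon_h(i)=1$ then $\varepsilon_k(i)=1$ and $\varepsilon_k(j)=\varepsilon_h(j)^\partial$ for $j\ne i$; if $\varepsilon_h(i)=\partial$ then $\varepsilon_k(i)=\partial$ and $\varepsilon_k(j)=\varepsilon_h(j)$ for $j\neq i$. In a perfect LE they are interpreted as the unique operations such that: $f(a_1,\dots,a_i,\dots,a_{n_f})\le b$ iff $a_i\le f_i^\sharp(a_1,\dots,b,\dots,a_{n_f})$ when $\varepsilon_f(i)=1$, and iff $f_i^\sharp(a_1,\dots,b,\dots,a_{n_f})\le a_i$ when $\varepsilon_f(i)=\partial$ ($b$ in position $i$); $b\le g(a_1,\dots,a_i,\dots,a_{n_g})$ iff $g_i^\flat(a_1,\dots,b,\dots,a_{n_g})\le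 a_i$ when $\varepsilon_g(i)=1$, and iff $a_i\le g_i^\flat(a_1,\dots,b,\dots,a_{n_g})$ when $\varepsilon_g(i)=\partial$. The terms of $\mathcal L_{\mathrm{LE}}^+$ are built from $\mathsf{PROP}$, $\bot,\top$, countably many nominals $\mathbf i,\mathbf j,\dots$ and co-nominals $\mathbf m,\mathbf n,\dots$ using $\wedge,\vee$ and $\mathcal F^*\cup\mathcal G^*$. An assignment on a perfect LE $\mathbb A$ sends propositional variables to elements of $\mathbb A$, nominals to $J^\infty(\mathbb A)$ and co-nominals to $M^\infty(\mathbb A)$. $\mathbb A\models$ (quasi-)inequality means it holds under all assignments. An expression is pure if it contains no propositional variables. **Signs.** The signed generation tree $+s$ (resp. $-s$) of a term $s$ labels the root of its syntax tree with $+$ (resp. $-$) and propagates: children of $\wedge,\vee$ nodes get the same sign; the $i$-th child of a node labelled by a connective $h$ gets the same sign if $\varepsilon_h(i)=1$ and the opposite sign if $\varepsilon_h(i)=\partial$. A term $s$ is positive (negative) in $p$ if all occurrences of $p$ in $+s$ are signed $+$ ($-$). An SLR node is a node $+f$ with $f\in\mathcal F$, $n_f\ge1$, or $-g$ with $g\in\mathcal G$, $n_g\ge1$; a branch is SLR if all its nodes other than its leaf are SLR nodes. $\phi'(!x)$ means that the variable $x$ occurs exactly once in $\phi'$; $\pm x\prec\ast s$ means that $x$ occurs with that sign in $\ast s$. **ALBA.** Input: an $\mathcal L_{\mathrm{LE}}$-inequality $\phi\le\psi$. *Stage 1 (preprocessing).* Exhaustively: replace $\alpha(p)\le\beta(p)$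 by $\alpha(\bot)\le\beta(\bot)$ if $\alpha$ is negative and $\beta$ positive in $p$; replace $\gamma(p)\le\delta(p)$ by $\gamma(\top)\le\delta(\top)$ if $\gamma$ is positive and $\delta$ negative in $p$. Then, considering $+$ of the left-hand side and $-$ of the right-hand side, exhaustively distribute positive $f\in\mathcal F$ nodes over $+\vee$ children (coordinates with $\varepsilon_f(i)=1$) and $-\wedge$ children (coordinates with $\varepsilon_f(i)=\partial$), turning them into joins of $f$-terms, and negative $g\in\mathcal G$ nodes over $-\wedge$ children ($\varepsilon_g(i)=1$) and $+\vee$ children ($\varepsilon_g(i)=\partial$), turning them into meets of $g$-terms; and exhaustively apply splitting: $\alpha\le\beta\wedge\gamma$ becomes $\alpha\le\beta$, $\alpha\le\gamma$; $\alpha\vee\beta\le\gamma$ becomes $\alpha\le\gamma$, $\beta\le\gamma$. This yields finitely many inequalities $\phi_i'\le\psi_i'$, each giving an initial system $(S_i,\mathsf{Ineq}_i)=(\emptyset,\phi_i'\le\psi_i')$. A system $(S,\mathsf{Ineq})$ (finite set of inequalities, inequality) represents the quasi-inequality ''conjunction of $S$ implies $\mathsf{Ineq}$''. *Stage 2 (reduction).* Each system is transformed separately by the following reduction rules, on $\mathcal L_{\mathrm{LE}}^+$-inequalities. (Approximation) For $\gamma\in\mathcal L_{\mathrm{LE}}$, $\mathbf j$ ($\mathbf m$) the first nominal (co-nominal) not occurring in the system, and the branch from the indicated occurrence of $x$ to the root being SLR: $(S,\phi'(\gamma/!x)\le\psi)$ becomes $(S\cup\{\mathbf j\le\gamma\},\phi'(\mathbf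 j/!x)\le\psi)$ if $+x\prec+\phi'(!x)$, or $(S\cup\{\gamma\le\mathbf m\},\phi'(\mathbf m/!x)\le\psi)$ if $-x\prec+\phi'(!x)$; $(S,\phi\le\psi'(\gamma/!x))$ becomes $(S\cup\{\mathbf j\le\gamma\},\phi\le\psi'(\mathbf j/!x))$ if $+x\prec-\psi'(!x)$, or $(S\cup\{\gamma\le\mathbf m\},\phi\le\psi'(\mathbf m/!x))$ if $-x\prec-\psi'(!x)$. (Residuation, replacing an inequality in $S$) For $f\in\mathcal F$: $f(\phi_1,\dots,\phi_i,\dots,\phi_{n_f})\le\psi$ becomes $\phi_i\le f_i^\sharp(\phi_1,\dots,\psi,\dots,\phi_{n_f})$ if $\varepsilon_f(i)=1$, and $f_i^\sharp(\phi_1,\dots,\psi,\dots,\phi_{n_f})\le\phi_i$ if $\varepsilon_f(i)=\partial$. For $g\in\mathcal G$: $\psi\le g(\phi_1,\dots,\phi_i,\dots,\phi_{n_g})$ becomes $g_i^\flat(\phi_1,\dots,\psi,\dots,\phi_{n_g})\le\phi_i$ if $\varepsilon_g(i)=1$, and $\phi_i\le g_i^\flat(\phi_1,\dots,\psi,\dots,\phi_{n_g})$ if $\varepsilon_g(i)=\partial$. (Splitting) The splitting rules of Stage 1, applied in $S$. (Right Ackermann) $(\{\alpha_i\le p\mid1\le i\le n\}\cup\{\beta_j(p)\le\gamma_j(p)\mid1\le j\le m\},\mathsf{Ineq})$ becomes $(\{\beta_j(\bigvee_i\alpha_i)\le\gamma_j(\bigvee_i\alpha_i)\mid1\le j\le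 m\},\mathsf{Ineq})$, provided $p$ does not occur in any $\alpha_i$ or in $\mathsf{Ineq}$, the $\beta_j$ are positive in $p$ and the $\gamma_j$ negative in $p$. (Left Ackermann) $(\{p\le\alpha_i\mid1\le i\le n\}\cup\{\beta_j(p)\le\gamma_j(p)\mid1\le j\le m\},\mathsf{Ineq})$ becomes $(\{\beta_j(\bigwedge_i\alpha_i)\le\gamma_j(\bigwedge_i\alpha_i)\mid1\le j\le m\},\mathsf{Ineq})$, provided $p$ does not occur in any $\alpha_i$ or in $\mathsf{Ineq}$, the $\beta_j$ are negative in $p$ and the $\gamma_j$ positive in $p$. *Stage 3.* ALBA succeeds (in an execution) if every system has been made pure; it then returns the conjunction $\mathsf{ALBA}(\phi\le\psi)$ of the resulting pure quasi-inequalities. Otherwise it fails. *)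

(* Defs.v *)
From Stdlib Require Import List Relation_Operators.
From HB Require Import structures.
From mathcomp Require Import all_boot all_order.
From mathcomp Require Import boolp classical_sets.

Set Implicit Arguments.
Unset Strict Implicit.
Unset Printing Implicit Defensive.

Local Open Scope order_scope.
Local Open Scope classical_set_scope.

Inductive otype := ot1 | otd.

Definition otflip (e : otype) : otype := if e is ot1 then otd else ot1.

(* [F] and [G] are disjoint by typing.  The denumerable set of propositional
   variables is [nat] for every language (see [atom] below). *)
Record LE_language := LELanguage {
  Fconn : Type;
  Gconn : Type;
  arF : Fconn -> nat;
  arG : Gconn -> nat;
  epsF : forall f : Fconn, 'I_(arF f) -> otype;
  epsG : forall g : Gconn, 'I_(arG g) -> otype }.

(* The connectives of [F* \cup G*].  [CSharp f i] lies in [G*] if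
   [epsF f i = ot1] and in [F*] otherwise; [CFlat g i] lies in [F*] if
   [epsG g i = ot1] and in [G*] otherwise. *)
Inductive conn (L : LE_language) :=
| CF (f : Fconn L)
| CG (g : Gconn L)
| CSharp (f : Fconn L) (i : 'I_(arF f))
| CFlat (g : Gconn L) (i : 'I_(arG g)).

Arguments CF {L} f.
Arguments CG {L} g.
Arguments CSharp {L} f i.
Arguments CFlat {L} g i.

Definition arity (L : LE_language) (c : conn L) : nat :=
  match c with
  | CF f => arF f
  | CG g => arG g
  | CSharp f _ => arF f
  | CFlat g _ => arG g
  end.

Definition residual_eps (n : nat) (e : 'I_n -> otype) (i : 'I_n) : 'I_n -> otype :=
  fun j => if j == i then e i
           else if e i is ot1 then otflip (e j) else e j.

Definition eps (L : LE_language) (c : conn L) : 'I_(arity c) -> otype :=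
  match c return 'I_(arity c) -> otype with
  | CF f => epsF (f := f)
  | CG g => epsG (g := g)
  | CSharp f i => residual_eps (epsF (f := f)) i
  | CFlat g i => residual_eps (epsG (g := g)) i
  end.

Inductive atom := PVar of nat | Nom of nat | CoNom of nat.

Definition atom_eqb (a b : atom) : bool :=
  match a, b with
  | PVar m, PVar n => m == n
  | Nom m, Nom n => m == n
  | CoNom m, CoNom n => m == n
  | _, _ => false
  end.

Lemma atom_eqP : Equality.axiom atom_eqb.
Proof.
case=> m; case=> n /=; try by constructor.
all: by apply: (iffP eqP) => [->|[]].
Qed.

HB.instance Definition _ := hasDecEq.Build atom atom_eqP.

Inductive term (L : LE_language) :=
| Atom (a : atom)
| Bot
| Top
| Meet (s t : term L)
| Join (s t : term L)
| App (c : conn L) (args : 'I_(arity c) -> term L).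

Arguments Atom {L} a.
Arguments Bot {L}.
Arguments Top {L}.
Arguments App {L} c args.

(* [upd a i x] is [(a_1, ..., x, ..., a_n)] with [x] in position [i]. *)
Definition upd (n : nat) (T : Type) (a : 'I_n -> T) (i : 'I_n) (x : T) : 'I_n -> T :=
  fun j => if j == i then x else a j.

Fixpoint LE_term (L : LE_language) (t : term L) : Prop :=
  match t with
  | Atom (PVar _) => True
  | Atom _ => False
  | Bot | Top => True
  | Meet s t | Join s t => LE_term s /\ LE_term t
  | App c args =>
      match c with CF _ | CG _ => True | _ => False end
      /\ forall i, LE_term (args i)
  end.

Fixpoint occ_count (L : LE_language) (a : atom) (t : term L) : nat :=
  match t with
  | Atom b => (a == b)
  | Bot | Top => 0
  | Meet s t | Join s t => occ_count a s + occ_count a t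
  | App c args => \sum_(i < arity c) occ_count a (args i)
  end.

Definition occurs (L : LE_language) (a : atom) (t : term L) : Prop :=
  (0 < occ_count a t)%N.

Fixpoint subst (L : LE_language) (a : atom) (u t : term L) : term L :=
  match t with
  | Atom b => if a == b then u else Atom b
  | Bot => Bot
  | Top => Top
  | Meet s t => Meet (subst a u s) (subst a u t)
  | Join s t => Join (subst a u s) (subst a u t)
  | App c args => App c (fun i => subst a u (args i))
  end.

Fixpoint bigJoin (L : LE_language) (s : seq (term L)) : term L :=
  match s with
  | [::] => Bot
  | [:: t] => t
  | t :: s => Join t (bigJoin s)
  end.

Fixpoint bigMeet (L : LE_language) (s : seq (term L)) : term L :=
  match s with
  | [::] => Top
  | [:: t] => t
  | t :: s => Meet t (bigMeet s)
  end.

Record ineq (L : LE_language) := Ineq { lhs : term L; rhs : term L }.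

Definition occurs_ineq (L : LE_language) (a : atom) (e : ineq L) : Prop :=
  occurs a (lhs e) \/ occurs a (rhs e).

Definition subst_ineq (L : LE_language) (a : atom) (u : term L) (e : ineq L) : ineq L :=
  Ineq (subst a u (lhs e)) (subst a u (rhs e)).

Inductive sign := plus | minus.

Definition sflip (s : sign) : sign := if s is plus then minus else plus.

Definition child_sign (s : sign) (e : otype) : sign :=
  if e is ot1 then s else sflip s.

(* [signed_occ a s r t]: the atom [a] occurs with sign [s] in the signed
   generation tree of [t] whose root is labelled [r]. *)
Fixpoint signed_occ (L : LE_language) (a : atom) (s r : sign) (t : term L) : Prop :=
  match t with
  | Atom b => b = a /\ r = s
  | Bot | Top => False
  | Meet t u | Join t u => signed_occ a s r t \/ signed_occ a s r u
  | App c args => exists i, signed_occ a s (child_sign r (eps i)) (args i)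
  end.

Definition positive_in (L : LE_language) (p : nat) (t : term L) : Prop :=
  forall s, signed_occ (PVar p) s plus t -> s = plus.

Definition negative_in (L : LE_language) (p : nat) (t : term L) : Prop :=
  forall s, signed_occ (PVar p) s plus t -> s = minus.

Definition SLR_node (L : LE_language) (r : sign) (c : conn L) : Prop :=
  match c, r with
  | CF f, plus => (1 <= arF f)%N
  | CG g, minus => (1 <= arG g)%N
  | _, _ => False
  end.

(* As [signed_occ], for an occurrence at the end of an SLR branch. *)
Fixpoint SLR_occ (L : LE_language) (a : atom) (s r : sign) (t : term L) : Prop :=
  match t with
  | Atom b => b = a /\ r = s
  | App c args =>
      SLR_node r c /\ exists i, SLR_occ a s (child_sign r (eps i)) (args i)
  | _ => False
  end.

(* [x] occurs exactly once in [t], with sign [s] in the tree of [t] rooted at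
   [r], and the branch from that occurrence to the root is SLR. *)
Definition once_SLR (L : LE_language) (x : nat) (s r : sign) (t : term L) : Prop :=
  occ_count (PVar x) t = 1%N /\ SLR_occ (PVar x) s r t.

Record LE (L : LE_language) (d : Order.disp_t) := MkLE {
  LEcarrier :> tbLatticeType d;
  opF : forall f : Fconn L, ('I_(arF f) -> LEcarrier) -> LEcarrier;
  opG : forall g : Gconn L, ('I_(arG g) -> LEcarrier) -> LEcarrier;
  opF_normal : forall (f : Fconn L) (i : 'I_(arF f))
      (a : 'I_(arF f) -> LEcarrier) (s : seq LEcarrier),
    match epsF i with
    | ot1 => opF (upd a i (\join_(x <- s) x)) = \join_(x <- s) opF (upd a i x)
    | otd => opF (upd a i (\meet_(x <- s) x)) = \join_(x <- s) opF (upd a i x)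
    end;
  opG_normal : forall (g : Gconn L) (i : 'I_(arG g))
      (a : 'I_(arG g) -> LEcarrier) (s : seq LEcarrier),
    match epsG i with
    | ot1 => opG (upd a i (\meet_(x <- s) x)) = \meet_(x <- s) opG (upd a i x)
    | otd => opG (upd a i (\join_(x <- s) x)) = \meet_(x <- s) opG (upd a i x)
    end }.

Definition completely_join_irreducible (d : Order.disp_t) (A : tbLatticeType d)
    (j : A) : Prop :=
  forall S : set A, supremums S j -> S j.

Definition completely_meet_irreducible (d : Order.disp_t) (A : tbLatticeType d)
    (m : A) : Prop :=
  forall S : set A, infimums S m -> S m.

Definition complete_lattice (d : Order.disp_t) (A : tbLatticeType d) : Prop :=
  forall S : set A, (exists s, supremums S s) /\ (exists s, infimums S s).

Definition perfect_lattice (d : Order.disp_t) (A : tbLatticeType d) : Prop :=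
  [/\ complete_lattice A,
      forall a : A, exists2 S : set A,
        S `<=` @completely_join_irreducible d A & supremums S a
    & forall a : A, exists2 S : set A,
        S `<=` @completely_meet_irreducible d A & infimums S a].

Definition perfect (L : LE_language) (d : Order.disp_t) (A : LE L d) : Prop :=
  [/\ perfect_lattice A,
      forall (f : Fconn L) (i : 'I_(arF f)) (a : 'I_(arF f) -> A) (S : set A) (s : A),
        (if epsF i is ot1 then supremums S s else infimums S s) ->
        supremums [set opF (upd a i x) | x in S] (opF (upd a i s))
    & forall (g : Gconn L) (i : 'I_(arG g)) (a : 'I_(arG g) -> A) (S : set A) (s : A),
        (if epsG i is ot1 then infimums S s else supremums S s) ->
        infimums [set opG (upd a i x) | x in S] (opG (upd a i s))].

(* The residuals are given by definite description: the value of
   [f_i^sharp (a_1, ..., b, ..., a_n)] (here [b] is [a i]) is the element that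
   the defining adjunction determines.  The default value [\bot] is
   irrelevant in a perfect LE, where this element exists. *)
Definition op_sharp (L : LE_language) (d : Order.disp_t) (A : LE L d)
    (f : Fconn L) (i : 'I_(arF f)) (a : 'I_(arF f) -> A) : A :=
  xget \bot [set z : A | forall x : A,
    opF (upd a i x) <= a i <-> (if epsF i is ot1 then x <= z else z <= x)].

Definition op_flat (L : LE_language) (d : Order.disp_t) (A : LE L d)
    (g : Gconn L) (i : 'I_(arG g)) (a : 'I_(arG g) -> A) : A :=
  xget \bot [set z : A | forall x : A,
    a i <= opG (upd a i x) <-> (if epsG i is ot1 then z <= x else x <= z)].

Definition op (L : LE_language) (d : Order.disp_t) (A : LE L d) (c : conn L) :
    ('I_(arity c) -> A) -> A :=
  match c return ('I_(arity c) -> A) -> A with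
  | CF f => @opF L d A f
  | CG g => @opG L d A g
  | CSharp f i => @op_sharp L d A f i
  | CFlat g i => @op_flat L d A g i
  end.

Record assignment (L : LE_language) (d : Order.disp_t) (A : LE L d) := Assignment {
  val_var : nat -> A;
  val_nom : nat -> A;
  val_conom : nat -> A;
  val_nomP : forall k, completely_join_irreducible (val_nom k);
  val_conomP : forall k, completely_meet_irreducible (val_conom k) }.

Fixpoint eval (L : LE_language) (d : Order.disp_t) (A : LE L d)
    (v : assignment A) (t : term L) : A :=
  match t with
  | Atom (PVar p) => val_var v p
  | Atom (Nom k) => val_nom v k
  | Atom (CoNom k) => val_conom v k
  | Bot => \bot
  | Top => \top
  | Meet s t => eval v s `&` eval v t
  | Join s t => eval v s `|` eval v t
  | App c args => op (fun i => eval v (args i))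
  end%O.

Definition holds (L : LE_language) (d : Order.disp_t) (A : LE L d)
    (v : assignment A) (e : ineq L) : Prop :=
  eval v (lhs e) <= eval v (rhs e).

Definition valid (L : LE_language) (d : Order.disp_t) (A : LE L d) (e : ineq L) : Prop :=
  forall v : assignment A, holds v e.

(* The list [sysS s] stands for the finite set of its members; a system is
   identified with the quasi-inequality that it represents. *)
Record system (L : LE_language) := System { sysS : seq (ineq L); sysI : ineq L }.

Definition holds_quasi (L : LE_language) (d : Order.disp_t) (A : LE L d)
    (v : assignment A) (s : system L) : Prop :=
  (forall e, List.In e (sysS s) -> holds v e) -> holds v (sysI s).

Definition valid_conj (L : LE_language) (d : Order.disp_t) (A : LE L d)
    (out : seq (system L)) : Prop :=
  forall v : assignment A, forall s, List.In s out -> holds_quasi v s.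

Definition occurs_system (L : LE_language) (a : atom) (s : system L) : Prop :=
  (exists2 e, List.In e (sysS s) & occurs_ineq a e) \/ occurs_ineq a (sysI s).

Definition pure_system (L : LE_language) (s : system L) : Prop :=
  forall p : nat, ~ occurs_system (PVar p) s.

(* The first premise ensures that the exhaustive application of these rules
   terminates: without it they would apply forever, changing nothing, to the
   variables that do not occur. *)
Inductive eliminate (L : LE_language) : ineq L -> ineq L -> Prop :=
| eliminate_bot (p : nat) (e : ineq L) :
    occurs_ineq (PVar p) e ->
    negative_in p (lhs e) -> positive_in p (rhs e) ->
    eliminate e (subst_ineq (PVar p) Bot e)
| eliminate_top (p : nat) (e : ineq L) :
    occurs_ineq (PVar p) e ->
    positive_in p (lhs e) -> negative_in p (rhs e) ->
    eliminate e (subst_ineq (PVar p) Top e).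

(* [distribute r t t']: one distribution step at some node of the generation
   tree of [t] with root sign [r]. *)
Inductive distribute (L : LE_language) : sign -> term L -> term L -> Prop :=
| distribute_F1 (f : Fconn L) (i : 'I_(arF f)) (args : 'I_(arF f) -> term L) s t :
    epsF i = ot1 -> args i = Join s t ->
    distribute plus (App (CF f) args)
      (Join (App (CF f) (upd args i s)) (App (CF f) (upd args i t)))
| distribute_Fd (f : Fconn L) (i : 'I_(arF f)) (args : 'I_(arF f) -> term L) s t :
    epsF i = otd -> args i = Meet s t ->
    distribute plus (App (CF f) args)
      (Join (App (CF f) (upd args i s)) (App (CF f) (upd args i t)))
| distribute_G1 (g : Gconn L) (i : 'I_(arG g)) (args : 'I_(arG g) -> term L) s t :
    epsG i = ot1 -> args i = Meet s t ->
    distribute minus (App (CG g) args)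
      (Meet (App (CG g) (upd args i s)) (App (CG g) (upd args i t)))
| distribute_Gd (g : Gconn L) (i : 'I_(arG g)) (args : 'I_(arG g) -> term L) s t :
    epsG i = otd -> args i = Join s t ->
    distribute minus (App (CG g) args)
      (Meet (App (CG g) (upd args i s)) (App (CG g) (upd args i t)))
| distribute_meetl r s s' t :
    distribute r s s' -> distribute r (Meet s t) (Meet s' t)
| distribute_meetr r s t t' :
    distribute r t t' -> distribute r (Meet s t) (Meet s t')
| distribute_joinl r s s' t :
    distribute r s s' -> distribute r (Join s t) (Join s' t)
| distribute_joinr r s t t' :
    distribute r t t' -> distribute r (Join s t) (Join s t')
| distribute_app r (c : conn L) (i : 'I_(arity c)) (args : 'I_(arity c) -> term L) t :
    distribute (child_sign r (eps i)) (args i) t ->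
    distribute r (App c args) (App c (upd args i t)).

Inductive split_ineq (L : LE_language) : ineq L -> seq (ineq L) -> Prop :=
| split_meet (a b c : term L) :
    split_ineq (Ineq a (Meet b c)) [:: Ineq a b; Ineq a c]
| split_join (a b c : term L) :
    split_ineq (Ineq (Join a b) c) [:: Ineq a c; Ineq b c].

Inductive distribute_split (L : LE_language) : ineq L -> seq (ineq L) -> Prop :=
| ds_left (s s' t : term L) :
    distribute plus s s' -> distribute_split (Ineq s t) [:: Ineq s' t]
| ds_right (s t t' : term L) :
    distribute minus t t' -> distribute_split (Ineq s t) [:: Ineq s t']
| ds_split (e : ineq L) (es : seq (ineq L)) :
    split_ineq e es -> distribute_split e es.

Inductive distribute_split_seq (L : LE_language) :
    seq (ineq L) -> seq (ineq L) -> Prop :=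
| ds_seq (E1 E2 : seq (ineq L)) (e : ineq L) (es : seq (ineq L)) :
    distribute_split e es ->
    distribute_split_seq (E1 ++ e :: E2) (E1 ++ es ++ E2).

Definition exhaustively (T : Type) (R : T -> T -> Prop) (x y : T) : Prop :=
  clos_refl_trans T R x y /\ forall z, ~ R y z.

Definition preprocess (L : LE_language) (e : ineq L) (E : seq (ineq L)) : Prop :=
  exists2 e', exhaustively (@eliminate L) e e'
            & exhaustively (@distribute_split_seq L) [:: e'] E.

Definition same_members (T : Type) (S S' : seq T) : Prop :=
  forall x, List.In x S <-> List.In x S'.

(* [mk] is [Nom] or [CoNom]. *)
Definition first_fresh (L : LE_language) (mk : nat -> atom) (k : nat) (s : system L) : Prop :=
  ~ occurs_system (mk k) s /\ forall k', (k' < k)%N -> occurs_system (mk k') s.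

Inductive residuate (L : LE_language) : ineq L -> ineq L -> Prop :=
| residuate_F1 (f : Fconn L) (i : 'I_(arF f)) (args : 'I_(arF f) -> term L) (t : term L) :
    epsF i = ot1 ->
    residuate (Ineq (App (CF f) args) t)
      (Ineq (args i) (App (CSharp f i) (upd args i t)))
| residuate_Fd (f : Fconn L) (i : 'I_(arF f)) (args : 'I_(arF f) -> term L) (t : term L) :
    epsF i = otd ->
    residuate (Ineq (App (CF f) args) t)
      (Ineq (App (CSharp f i) (upd args i t)) (args i))
| residuate_G1 (g : Gconn L) (i : 'I_(arG g)) (args : 'I_(arG g) -> term L) (t : term L) :
    epsG i = ot1 ->
    residuate (Ineq t (App (CG g) args))
      (Ineq (App (CFlat g i) (upd args i t)) (args i))
| residuate_Gd (g : Gconn L) (i : 'I_(arG g)) (args : 'I_(arG g) -> term L) (t : term L) :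
    epsG i = otd ->
    residuate (Ineq t (App (CG g) args))
      (Ineq (args i) (App (CFlat g i) (upd args i t))).

Inductive reduce (L : LE_language) : system L -> system L -> Prop :=
| approx_lhs_nom S (phi gamma psi : term L) (x k : nat) :
    LE_term gamma -> once_SLR x plus plus phi ->
    first_fresh Nom k (System S (Ineq (subst (PVar x) gamma phi) psi)) ->
    reduce (System S (Ineq (subst (PVar x) gamma phi) psi))
      (System (Ineq (Atom (Nom k)) gamma :: S)
              (Ineq (subst (PVar x) (Atom (Nom k)) phi) psi))
| approx_lhs_conom S (phi gamma psi : term L) (x k : nat) :
    LE_term gamma -> once_SLR x minus plus phi ->
    first_fresh CoNom k (System S (Ineq (subst (PVar x) gamma phi) psi)) ->
    reduce (System S (Ineq (subst (PVar x) gamma phi) psi))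
      (System (Ineq gamma (Atom (CoNom k)) :: S)
              (Ineq (subst (PVar x) (Atom (CoNom k)) phi) psi))
| approx_rhs_nom S (phi psi gamma : term L) (x k : nat) :
    LE_term gamma -> once_SLR x plus minus psi ->
    first_fresh Nom k (System S (Ineq phi (subst (PVar x) gamma psi))) ->
    reduce (System S (Ineq phi (subst (PVar x) gamma psi)))
      (System (Ineq (Atom (Nom k)) gamma :: S)
              (Ineq phi (subst (PVar x) (Atom (Nom k)) psi)))
| approx_rhs_conom S (phi psi gamma : term L) (x k : nat) :
    LE_term gamma -> once_SLR x minus minus psi ->
    first_fresh CoNom k (System S (Ineq phi (subst (PVar x) gamma psi))) ->
    reduce (System S (Ineq phi (subst (PVar x) gamma psi)))
      (System (Ineq gamma (Atom (CoNom k)) :: S)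
              (Ineq phi (subst (PVar x) (Atom (CoNom k)) psi)))
| residuation S S0 (e e' : ineq L) I :
    same_members S (e :: S0) -> ~ List.In e S0 -> residuate e e' ->
    reduce (System S I) (System (e' :: S0) I)
| splitting S S0 (e : ineq L) (es : seq (ineq L)) I :
    same_members S (e :: S0) -> ~ List.In e S0 -> split_ineq e es ->
    reduce (System S I) (System (es ++ S0) I)
| right_Ackermann S (p : nat) (alphas : seq (term L)) (bs : seq (ineq L)) I :
    same_members S ([seq Ineq a (Atom (PVar p)) | a <- alphas] ++ bs) ->
    (forall a, List.In a alphas -> ~ occurs (PVar p) a) ->
    ~ occurs_ineq (PVar p) I ->
    (forall b, List.In b bs -> positive_in p (lhs b) /\ negative_in p (rhs b)) ->
    reduce (System S I)
      (System [seq subst_ineq (PVar p) (bigJoin alphas) b | b <- bs] I)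
| left_Ackermann S (p : nat) (alphas : seq (term L)) (bs : seq (ineq L)) I :
    same_members S ([seq Ineq (Atom (PVar p)) a | a <- alphas] ++ bs) ->
    (forall a, List.In a alphas -> ~ occurs (PVar p) a) ->
    ~ occurs_ineq (PVar p) I ->
    (forall b, List.In b bs -> negative_in p (lhs b) /\ positive_in p (rhs b)) ->
    reduce (System S I)
      (System [seq subst_ineq (PVar p) (bigMeet alphas) b | b <- bs] I).

(* [ALBA_output e out]: some execution of ALBA on [e] succeeds, with the
   conjunction of [out] as output. *)
Definition ALBA_output (L : LE_language) (e : ineq L) (out : seq (system L)) : Prop :=
  exists2 E : seq (ineq L), preprocess e E &
    List.Forall2 (fun e' s =>
      clos_refl_trans (system L) (@reduce L) (System [::] e') s /\ pure_system s) E out.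

(* Main.v *)
(* Every step of ALBA preserves validity in [A].  Residuation and splitting are
   equivalences under each assignment.  For approximation, an SLR branch makes
   the term completely join- or meet-preserving in the marked occurrence, and
   [gamma] is the join (meet) of the irreducibles below (above) it, so a fresh
   nominal (co-nominal) ranges over enough values.  For the Ackermann rules, the
   join (meet) of the [alpha_i] is the extremal value of [p], and the other
   inequalities are monotone in [p]; the residuals are monotone as their
   order-types prescribe. *)

Require Import Defs.
From Stdlib Require Import List Relation_Operators.
From mathcomp Require Import all_boot all_order.
From mathcomp Require Import boolp classical_sets.

Set Implicit Arguments.
Unset Strict Implicit.
Unset Printing Implicit Defensive.

Import Order.TTheory.

Local Open Scope order_scope.
Local Open Scope classical_set_scope.

(** * Signs and one-coordinate updates of tuples *)

Lemma child_sign_flipl s e : child_sign (sflip s) e = sflip (child_sign s e).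
Proof. by case: s; case: e. Qed.

Lemma child_sign_flipr s e : child_sign s (otflip e) = sflip (child_sign s e).
Proof. by case: s; case: e. Qed.

Lemma child_signK s e : child_sign (child_sign s e) e = s.
Proof. by case: s; case: e. Qed.

Lemma upd_id n T (a : 'I_n -> T) i : upd a i (a i) = a.
Proof. by apply: funext => j; rewrite /upd; case: eqP => [->|]. Qed.

Lemma upd_same n T (a : 'I_n -> T) i x : upd a i x i = x.
Proof. by rewrite /upd eqxx. Qed.

Lemma upd_upd n T (a : 'I_n -> T) i x y : upd (upd a i x) i y = upd a i y.
Proof. by apply: funext => j; rewrite /upd; case: eqP. Qed.

Lemma comp_upd n T U (F : T -> U) (a : 'I_n -> T) i x :
  (fun j => F (upd a i x j)) = upd (fun j => F (a j)) i (F x).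
Proof. by apply: funext => j; rewrite /upd; case: eqP. Qed.

(** * Order, bounds, monotonicity and residuals relative to a sign *)

Section SignedOrder.
Variables (d : Order.disp_t) (A : tbLatticeType d).
Implicit Types (r s : sign) (x y z : A) (T : set A).

(* At the sign [minus] the order, the bounds and the irreducibles are dualised,
   so that one argument serves [F] at [plus] and [G] at [minus]. *)
Definition sle r x y := if r is plus then x <= y else y <= x.

Definition sbound r T x := if r is plus then supremums T x else infimums T x.

Definition sirreducible r x :=
  if r is plus then completely_join_irreducible x
  else completely_meet_irreducible x.

Lemma sle_refl r x : sle r x x.
Proof. by case: r => /=. Qed.

Lemma sle_trans r x y z : sle r x y -> sle r y z -> sle r x z.
Proof. by case: r => /= xy yz; [apply: le_trans yz | apply: le_trans xy]. Qed.

Lemma sle_flip r x y : sle (sflip r) x y = sle r y x.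
Proof. by case: r. Qed.

(** Universal property of a bound: with [u := x] it says that [x] bounds [T], and from right to left
    that [x] is extremal. Later arguments use only this form. *)
Lemma sboundE r T x :
  sbound r T x <-> forall u, sle r x u <-> (forall y, T y -> sle r y u).
Proof.
case: r; split => /=.
- move=> [ub lb] u; split=> [xu y Ty|h]; first by apply: le_trans xu; apply: ub.
  exact: lb.
- move=> h; split; first by move=> y Ty; apply: (h x).1.
  by move=> u hu; apply/h.
- move=> [ub lb] u; split=> [xu y Ty|h]; first by apply: (le_trans xu); apply: ub.
  exact: lb.
- move=> h; split; first by move=> y Ty; apply: (h x).1.
  by move=> u hu; apply/h.
Qed.

Lemma sbound_le r T x y : sbound r T x -> T y -> sle r y x.
Proof. by move=> /sboundE/(_ x)[h _]; apply: h; apply: sle_refl. Qed.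

(** Turns comparability into a bound, so that preservation of bounds yields monotonicity. *)
Lemma sbound_pair r x y : sle r x y -> sbound r [set x; y] y.
Proof.
move=> xy; apply/sboundE => u; split=> [yu z [->|->] //|]; last by apply; right.
exact: sle_trans yu.
Qed.

(** Enlarging a generating family to all irreducibles on the same side of [x] leaves the bound
    unchanged. The enlarged family consists of the values that a nominal or co-nominal constrained
    by [x] can take. *)
Lemma sbound_irreducible r x : perfect_lattice A ->
  sbound r [set y | sirreducible r y /\ sle r y x] x.
Proof.
move=> [_ hJ hM].
have [T Tirr Tx] : exists2 T : set A, T `<=` sirreducible r & sbound r T x.
  by case: r; [apply: hJ | apply: hM].
apply/sboundE => u; split=> [xu y [_ yx]|h]; first exact: sle_trans xu.
apply/(sboundE r T x).1 => // y Ty; apply: h; split; first exact: Tirr.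
exact: sbound_le Ty.
Qed.

Definition monotone n (e : 'I_n -> otype) (h : ('I_n -> A) -> A) :=
  forall r a b, (forall j, sle (child_sign r (e j)) (a j) (b j)) ->
    sle r (h a) (h b).

(** Flipping the root sign flips every child sign, which only exchanges [a] and [b]. *)
Lemma monotone_one_sign r n (e : 'I_n -> otype) (h : ('I_n -> A) -> A) :
  (forall a b, (forall j, sle (child_sign r (e j)) (a j) (b j)) ->
    sle r (h a) (h b)) -> monotone e h.
Proof.
move=> hr s a b; have [->|->] : s = r \/ s = sflip r.
- by case: s; case: r {hr}; auto.
- exact: hr.
move=> hab; rewrite sle_flip; apply: hr => j.
by rewrite -sle_flip -child_sign_flipl.
Qed.

Lemma coordinatewise_monotone r n (e : 'I_n -> otype) (h : ('I_n -> A) -> A) :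
  (forall i a x y, sle (child_sign r (e i)) x y ->
    sle r (h (upd a i x)) (h (upd a i y))) ->
  monotone e h.
Proof.
move=> hc; apply: (monotone_one_sign (r := r)) => a b hab.
(* [hyb k] takes its first [k] entries from [b] and the others from [a]; passing from [k] to [k.+1]
   changes coordinate [k] alone. *)
pose hyb k := fun j : 'I_n => if (j < k)%N then b j else a j.
have step k : (k <= n)%N -> sle r (h a) (h (hyb k)).
  elim: k => [_|k IH kn].
    have -> : hyb 0%N = a by apply: funext => j; rewrite /hyb ltn0.
    exact: sle_refl.
  apply: sle_trans (IH (ltnW kn)) _; pose i := Ordinal kn.
  have -> : hyb k = upd (hyb k) i (a i).
    by rewrite -{1}(upd_id (hyb k) i) {2}/hyb /= ltnn.
  have -> : hyb k.+1 = upd (hyb k) i (b i).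
    apply: funext => j; rewrite /hyb /upd ltnS leq_eqVlt -val_eqE /=.
    by case: eqP => //= jk; congr b; apply: val_inj.
  exact: hc.
have <- : hyb n = b by apply: funext => j; rewrite /hyb ltn_ord.
exact: step.
Qed.

(** At [plus] this is the law of the operations in F of a perfect LE, at [minus] that of the
    operations in G. *)
Definition completely_preserving r n (e : 'I_n -> otype)
    (h : ('I_n -> A) -> A) :=
  forall i a T x, sbound (child_sign r (e i)) T x ->
    sbound r [set h (upd a i y) | y in T] (h (upd a i x)).

Lemma preserving_monotone r n (e : 'I_n -> otype) (h : ('I_n -> A) -> A) :
  completely_preserving r e h -> monotone e h.
Proof.
move=> hP; apply: (coordinatewise_monotone (r := r)) => i a x y xy.
by apply: sbound_le (hP i a _ _ (sbound_pair xy)) _; exists x => //; left.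
Qed.

(** The entry [a i] is the parameter $b$ of the adjunction. At [plus] the set describes
    $f_i^\sharp$, at [minus] $g_i^\flat$. *)
Definition residual_set r n (e : 'I_n -> otype) (h : ('I_n -> A) -> A) i a
    : set A :=
  [set z | forall x,
     sle r (h (upd a i x)) (a i) <-> sle (child_sign r (e i)) x z].

(** The witness is the bound of all solutions [x]: preservation makes it a solution, and
    monotonicity makes everything on its inner side one too. *)
Lemma residual_exists r n (e : 'I_n -> otype) (h : ('I_n -> A) -> A) i a :
  complete_lattice A -> completely_preserving r e h ->
  exists z, residual_set r e h i a z.
Proof.
move=> cA hP; pose T := [set x | sle r (h (upd a i x)) (a i)].
have [z Tz] : exists z, sbound (child_sign r (e i)) T z.
  by have [] := cA T; case: (child_sign _ _).
exists z => x; split=> [hx|xz]; first exact: (sbound_le Tz).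
apply: sle_trans (_ : sle r _ (h (upd a i z))) _.
  apply: (preserving_monotone hP) => j; rewrite /upd.
  by case: eqP => [->//|_]; apply: sle_refl.
have /sboundE hz := hP i a _ _ Tz.
by apply/hz => _ [y Ty <-].
Qed.

Lemma residual_monotone r n (e : 'I_n -> otype) (h : ('I_n -> A) -> A)
    (k : ('I_n -> A) -> A) i :
  monotone e h -> (forall a, residual_set r e h i a (k a)) ->
  monotone (residual_eps e i) k.
Proof.
move=> hm kP; apply: (monotone_one_sign (r := child_sign r (e i))) => a b hab.
(* The adjunction at [b] reduces the goal to the chain [h (upd b i (k a))], [h (upd a i (k a))],
   [a i], [b i]. *)
apply/(kP b); have := (kP a (k a)).2 (sle_refl _ _) => ha.
apply: sle_trans (_ : sle r _ (h (upd a i (k a)))) _.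
  apply: hm => j; rewrite /upd.
  (* For [j] other than [i], [residual_eps] gives, in both cases of [e i], the sign opposite to that
     of [h] at [j]; hence [b j] and [a j] appear in reversed order. *)
  have := hab j; rewrite /residual_eps; case: eqP => [_ _|ji].
    exact: sle_refl.
  case: (e i); first by rewrite /= child_sign_flipr sle_flip.
  by rewrite /= child_sign_flipl sle_flip.
by apply: sle_trans ha _; have := hab i; rewrite /residual_eps eqxx child_signK.
Qed.

End SignedOrder.

(** * Preservation, adjunction and monotonicity of the operations of a perfect LE *)

Section PerfectLE.
Variables (L : LE_language) (d : Order.disp_t) (A : LE L d).
Hypothesis pA : perfect A.

Lemma opF_preserving (f : Fconn L) :
  completely_preserving plus (epsF (f := f)) (opF (l := A) (f := f)).
Proof.
case: pA => _ hF _ i a T x; move: (hF f i a T x).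
by case: (epsF i).
Qed.

Lemma opG_preserving (g : Gconn L) :
  completely_preserving minus (epsG (g := g)) (opG (l := A) (g := g)).
Proof.
case: pA => _ _ hG i a T x; move: (hG g i a T x).
by case: (epsG i).
Qed.

(** A residual exists by completeness, so [xget] returns an element satisfying the adjunction and
    not by default. *)
Lemma op_sharpP (f : Fconn L) (i : 'I_(arF f)) (a : 'I_(arF f) -> A) :
  residual_set plus (epsF (f := f)) (opF (l := A) (f := f)) i a
    (op_sharp i a).
Proof.
case: (pA) => -[cA _ _] _ _.
have [z hz] := residual_exists i a cA (@opF_preserving f).
rewrite /op_sharp; set P := (X in xget _ X).
have PE y : P y -> residual_set plus (epsF (f := f)) (opF (l := A) (f := f)) i a y.
  by move=> Py x; move: (Py x); case: (epsF i).
apply: PE; apply: (xgetPex _ (ex_intro _ z _)).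
by move=> x; move: (hz x); case: (epsF i).
Qed.

Lemma op_flatP (g : Gconn L) (i : 'I_(arG g)) (a : 'I_(arG g) -> A) :
  residual_set minus (epsG (g := g)) (opG (l := A) (g := g)) i a
    (op_flat i a).
Proof.
case: (pA) => -[cA _ _] _ _.
have [z hz] := residual_exists i a cA (@opG_preserving g).
rewrite /op_flat; set P := (X in xget _ X).
have PE y : P y -> residual_set minus (epsG (g := g)) (opG (l := A) (g := g)) i a y.
  by move=> Py x; move: (Py x); case: (epsG i).
apply: PE; apply: (xgetPex _ (ex_intro _ z _)).
by move=> x; move: (hz x); case: (epsG i).
Qed.

(** Residuals are included because the Ackermann rules substitute inside terms that residuation has
    produced. *)
Lemma op_monotone (c : conn L) : monotone (eps (c := c)) (@op L d A c).
Proof.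
case: c => [f|g|f i|g i] /=.
- exact: preserving_monotone (@opF_preserving f).
- exact: preserving_monotone (@opG_preserving g).
- apply: residual_monotone (op_sharpP i).
  exact: preserving_monotone (@opF_preserving f).
- apply: residual_monotone (op_flatP i).
  exact: preserving_monotone (@opG_preserving g).
Qed.

(** * Evaluation, substitution and monotonicity in a variable *)

Lemma eval_agree (v w : assignment A) (t : term L) :
  (forall a, occurs a t -> eval v (Atom a) = eval w (Atom a)) ->
  eval v t = eval w t.
Proof.
elim: t => [a|||s IHs t IHt|s IHs t IHt|c args IH] //= h.
- by apply: h; rewrite /occurs /= eqxx.
- by rewrite IHs ?IHt // => a ha; apply: h; rewrite /occurs /= addn_gt0 ha ?orbT.
- by rewrite IHs ?IHt // => a ha; apply: h; rewrite /occurs /= addn_gt0 ha ?orbT.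
- congr op; apply: funext => i; apply: IH => a ha; apply: h.
  by rewrite /occurs /= (bigD1 i) //= addn_gt0 ha.
Qed.

Definition set_var (v : assignment A) (p : nat) x : assignment A :=
  Assignment (fun q => if p == q then x else val_var v q)
    (@val_nomP _ _ _ v) (@val_conomP _ _ _ v).

Lemma set_var_fresh v p x t :
  ~ occurs (PVar p) t -> eval (set_var v p x) t = eval v t.
Proof.
move=> nt; apply: eval_agree => -[q|//|//] hq /=.
by case: eqP => // pq; case: nt; rewrite pq.
Qed.

Lemma eval_subst v p u t :
  eval v (subst (PVar p) u t) = eval (set_var v p (eval v u)) t.
Proof.
elim: t => [[q|k|k]|||s IHs t IHt|s IHs t IHt|c args IH] //=.
- have -> : (PVar p == PVar q) = (p == q) by [].
  by case: ifP.
- by rewrite IHs IHt.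
- by rewrite IHs IHt.
- by congr op; apply: funext => i.
Qed.

Lemma set_var_id v p t : eval (set_var v p (val_var v p)) t = eval v t.
Proof. by apply: eval_agree => -[q|//|//] _ /=; case: eqP => // ->. Qed.

(** Comparing [x] and [y] only at the signs with which [p] occurs lets one induction serve positive
    and negative terms, and pass through sign-reversing coordinates. *)
Lemma eval_monotone v p x y t r :
  (forall s, signed_occ (PVar p) s r t -> sle s x y) ->
  sle r (eval (set_var v p x) t) (eval (set_var v p y) t).
Proof.
elim: t r => [[q|k|k]|||s IHs t IHt|s IHs t IHt|c args IH] r h;
  try exact: sle_refl.
- by rewrite /=; case: eqP => [pq|_]; [apply: h; rewrite /= pq | apply: sle_refl].
- have := IHs r (fun s0 h0 => h s0 (or_introl h0)).
  have := IHt r (fun s0 h0 => h s0 (or_intror h0)).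
  by case: r {h} => /= h1 h2; apply: leI2.
- have := IHs r (fun s0 h0 => h s0 (or_introl h0)).
  have := IHt r (fun s0 h0 => h s0 (or_intror h0)).
  by case: r {h} => /= h1 h2; apply: leU2.
- apply: op_monotone => j; apply: IH => s0 h0; apply: h; by exists j.
Qed.

Lemma eval_positive v p x y t : positive_in p t -> x <= y ->
  eval (set_var v p x) t <= eval (set_var v p y) t.
Proof. by move=> pt xy; apply: (@eval_monotone v p _ _ t plus) => s /pt ->. Qed.

Lemma eval_negative v p x y t : negative_in p t -> x <= y ->
  eval (set_var v p y) t <= eval (set_var v p x) t.
Proof. by move=> pt xy; apply: (@eval_monotone v p _ _ t plus) => s /pt ->. Qed.

(** * Complete preservation along SLR branches *)

Lemma SLR_occ_occurs a s r (t : term L) : SLR_occ a s r t -> occurs a t.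
Proof.
rewrite /occurs; elim: t r => [b|||||c args IH] r //=; first by case=> ->; rewrite eqxx.
by case=> _ [i /IH h]; rewrite (bigD1 i) //= addn_gt0 h.
Qed.

(** As a function of [p], the term is a composite of one-coordinate maps, each completely preserving
    for the sign of its node. *)
Lemma SLR_preserving v p s r (t : term L) (T : set A) x :
  once_SLR p s r t -> sbound s T x ->
  sbound r [set eval (set_var v p y) t | y in T] (eval (set_var v p x) t).
Proof.
move=> [] + + Tx; elim: t r => [b|||||c args IH] r //=.
  move=> _ [-> ->] /=; rewrite eqxx.
  by have -> : [set y | y in T] = T by exact: image_id.
move=> once [slr [i hi]].
have /= := SLR_occ_occurs hi; rewrite /occurs => oi.
move: once; rewrite (bigD1 i) //= => once.
have [once_i others] : occ_count (PVar p) (args i) = 1%N /\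
    (\sum_(j < arity c | j != i) occ_count (PVar p) (args j) = 0)%N.
  by move: oi once; case: occ_count => [|[|m]] // _ [].
(* The single occurrence of [p] lies in [args i], so the other arguments do not vary with [y]. *)
have argsE y : (fun j => eval (set_var v p y) (args j)) =
    upd (fun j => eval v (args j)) i (eval (set_var v p y) (args i)).
  apply: funext => j; rewrite /upd; case: eqP => [->//|/eqP ji].
  apply: set_var_fresh; rewrite /occurs.
  by move/eqP: others; rewrite sum_nat_eq0 => /forall_inP/(_ j ji)/eqP ->.
rewrite argsE; have := IH i _ once_i hi.
have -> : [set op (fun j => eval (set_var v p y) (args j)) | y in T] =
    [set op (upd (fun j => eval v (args j)) i z) |
       z in [set eval (set_var v p y) (args i) | y in T]].
  rewrite image_comp; congr image; apply: funext => y /=.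
  by rewrite argsE.
(* [SLR_node] leaves only $+f$ and $-g$, the two cases in which the operation is completely
   preserving for the sign of its node. *)
case: c args r slr {IH once others argsE} i hi oi once_i => [f|g|//|//] args [] //= _ i _ _ _.
- exact: opF_preserving.
- exact: opG_preserving.
Qed.

(** * Approximation *)

Definition sineq r (t u : term L) := if r is plus then Ineq t u else Ineq u t.

Lemma holds_sineq (v : assignment A) r t u :
  holds v (sineq r t u) = sle r (eval v t) (eval v u).
Proof. by case: r. Qed.

Lemma occurs_sineq a r t u :
  occurs_ineq a (sineq r t u) <-> occurs a t \/ occurs a u.
Proof. by case: r; rewrite /occurs_ineq /=; tauto. Qed.

(** With [sineq], this makes the four approximation rules instances of one statement: [r] fixes the
    side of the inequality and [s] chooses between nominal and co-nominal. *)
Definition approximant s k := if s is plus then Nom k else CoNom k.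

Lemma approximant_irreducible (v : assignment A) s k :
  sirreducible s (eval v (Atom (approximant s k))).
Proof. by case: s; [apply: val_nomP | apply: val_conomP]. Qed.

Lemma approximant_variant (v : assignment A) s k x : sirreducible s x ->
  exists w : assignment A, eval w (Atom (approximant s k)) = x /\
    forall a, a <> approximant s k -> eval w (Atom a) = eval v (Atom a).
Proof.
case: s => /= ix.
- have iw l : completely_join_irreducible (if l == k then x else val_nom v l).
    by case: eqP => // _; apply: val_nomP.
  exists (Assignment (val_var v) iw (@val_conomP _ _ _ v)) => /=; rewrite eqxx.
  by split=> // -[] //= l; case: eqP => // ->.
- have iw l : completely_meet_irreducible (if l == k then x else val_conom v l).
    by case: eqP => // _; apply: val_conomP.
  exists (Assignment (val_var v) (@val_nomP _ _ _ v) iw) => /=; rewrite eqxx.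
  by split=> // -[] //= l; case: eqP => // ->.
Qed.

(** Carries freshness from a substituted term back to [t], and also to [u] when the variable occurs
    in [t]. *)
Lemma occ_count_subst a p (u t : term L) : a <> PVar p ->
  occ_count a (subst (PVar p) u t) =
  (occ_count a t + occ_count (PVar p) t * occ_count a u)%N.
Proof.
move=> ap; elim: t => [b|||s IHs t IHt|s IHs t IHt|c args IH] //=.
- case: (PVar p =P b) => [<-|_] /=; last by rewrite addn0.
  by rewrite mul1n; case: eqP.
- by rewrite IHs IHt mulnDl addnACA.
- by rewrite IHs IHt mulnDl addnACA.
- by rewrite big_distrl -big_split; apply: eq_bigr.
Qed.

(** Assignments are quantified within each system: approximation and Ackermann steps change values
    of atoms, so the equivalence proved for them is one of validity, not of truth under a fixed
    assignment. *)
Definition valid_system (s : system L) := forall v : assignment A, holds_quasi v s.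

Lemma approximation_sound r s S (t gamma u : term L) x k :
  once_SLR x s r t ->
  ~ occurs_system (approximant s k)
      (System S (sineq r (subst (PVar x) gamma t) u)) ->
  valid_system (System S (sineq r (subst (PVar x) gamma t) u)) <->
  valid_system (System (sineq s (Atom (approximant s k)) gamma :: S)
    (sineq r (subst (PVar x) (Atom (approximant s k)) t) u)).
Proof.
move=> slr fresh; set j := approximant s k in fresh *.
have [pL _ _] := pA.
have slrE v := (sboundE _ _ _).1
  (SLR_preserving v slr (sbound_irreducible s (eval v gamma) pL)).
split=> valid_s v /=; rewrite /holds_quasi /= => hS.
  rewrite holds_sineq eval_subst.
  have := valid_s v; rewrite /holds_quasi /= holds_sineq eval_subst => hv.
  (* The value of [j] is one of the irreducibles whose images have the value at [gamma] as their
     bound. *)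
  apply: ((slrE v _).1 (hv _)).
    by move=> e he; apply: hS; right.
  exists (eval v (Atom j)) => //; split; first exact: approximant_irreducible.
  by rewrite -holds_sineq; apply: hS; left.
(* It suffices to treat each irreducible [y] separately; the variant [w] gives [j] the value [y]
   and, by freshness, leaves the rest of the system unchanged. *)
rewrite holds_sineq eval_subst; apply/slrE => _ [y [iy ygamma] <-].
have [w [wj wa]] := approximant_variant v k iy.
have fresh_eval t' : ~ occurs j t' -> eval w t' = eval v t'.
  by move=> nt; apply: eval_agree => a ha; apply: wa => aj; apply: nt; rewrite /j -aj.
have jx : j <> PVar x by rewrite /j; case: (s).
have ju : ~ occurs j u.
  by move=> ju; apply: fresh; right; apply/occurs_sineq; right.
have jsub : ~ occurs j (subst (PVar x) gamma t).
  by move=> js; apply: fresh; right; apply/occurs_sineq; left.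
have jt : ~ occurs j t.
  by move=> h; apply: jsub; rewrite /occurs occ_count_subst // addn_gt0 h.
have jgamma : ~ occurs j gamma.
  move=> h; apply: jsub; rewrite /occurs occ_count_subst // slr.1 mul1n.
  by rewrite addn_gt0 h orbT.
have := valid_s w; rewrite /holds_quasi /= holds_sineq eval_subst wj.
rewrite (fresh_eval _ ju) => hw.
have -> : eval (set_var v x y) t = eval (set_var w x y) t.
  apply: eval_agree => -[q|l|l] ha //=; [|symmetry..].
  - by case: eqP => // _; rewrite -[LHS]/(eval v (Atom (PVar q))) -wa // /j; case: (s).
  - by apply: (wa (Nom l)) => E; apply: jt; rewrite /j -E.
  - by apply: (wa (CoNom l)) => E; apply: jt; rewrite /j -E.
apply: hw => e [<-|he].
  by rewrite holds_sineq wj (fresh_eval _ jgamma).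
rewrite /holds !fresh_eval; first exact: hS.
- by move=> h; apply: fresh; left; exists e => //; right.
- by move=> h; apply: fresh; left; exists e => //; left.
Qed.

(** * Residuation, splitting and the Ackermann rules *)

Lemma residuate_sound (v : assignment A) e e' :
  residuate e e' -> holds v e <-> holds v e'.
Proof.
by case=> h i args t ei;
  [have := op_sharpP i | have := op_sharpP i
  | have := op_flatP i | have := op_flatP i];
  (* The adjunction is taken at the tuple with the value of [t] in position [i], and at the point
     [args i]. *)
  move/(_ (upd (fun j => eval v (args j)) i (eval v t)) (eval v (args i)));
  rewrite ei upd_upd upd_same (upd_id (fun j => eval v (args j)) i);
  rewrite /holds /= (comp_upd (eval v)).
Qed.

Lemma split_sound (v : assignment A) e es :
  split_ineq e es -> holds v e <-> (forall e', List.In e' es -> holds v e').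
Proof.
case=> a b c; rewrite /holds /= ?lexI ?leUx; split.
- by move=> /andP[h1 h2] e' [<-|[<-|[]]].
- by move=> h; apply/andP; split; [apply: (h (Ineq a b)) | apply: (h (Ineq a c))]; rewrite /=; auto.
- by move=> /andP[h1 h2] e' [<-|[<-|[]]].
- by move=> h; apply/andP; split; [apply: (h (Ineq a c)) | apply: (h (Ineq b c))]; rewrite /=; auto.
Qed.

Lemma bigJoin_le (v : assignment A) ts x :
  eval v (bigJoin ts) <= x <-> (forall t, List.In t ts -> eval v t <= x).
Proof.
elim: ts => [|t [|t' ts] IH]; first by split=> // _; apply: le0x.
  by split=> [h _ [<-|[]] //|]; apply; left.
rewrite -[eval v _]/(eval v t `|` eval v (bigJoin (t' :: ts)))%O leUx; split.
- by move=> /andP[h1 /IH h2] u [<-//|]; apply: h2.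
- by move=> h; apply/andP; split; [apply: h; left | apply/IH => u hu; apply: h; right].
Qed.

Lemma bigMeet_ge (v : assignment A) ts x :
  x <= eval v (bigMeet ts) <-> (forall t, List.In t ts -> x <= eval v t).
Proof.
elim: ts => [|t [|t' ts] IH]; first by split=> // _; apply: lex1.
  by split=> [h _ [<-|[]] //|]; apply; left.
rewrite -[eval v _]/(eval v t `&` eval v (bigMeet (t' :: ts)))%O lexI; split.
- by move=> /andP[h1 /IH h2] u [<-//|]; apply: h2.
- by move=> h; apply/andP; split; [apply: h; left | apply/IH => u hu; apply: h; right].
Qed.

Lemma holds_subst (v : assignment A) p u e :
  holds v (subst_ineq (PVar p) u e) = holds (set_var v p (eval v u)) e.
Proof. by rewrite /holds /= !eval_subst. Qed.

Lemma holds_set_var_fresh v p x e :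
  ~ occurs_ineq (PVar p) e -> holds (set_var v p x) e = holds v e.
Proof.
by move=> h; rewrite /holds !set_var_fresh // => h'; apply: h; [right|left].
Qed.

Lemma holds_set_var_id v p e : holds (set_var v p (val_var v p)) e = holds v e.
Proof. by rewrite /holds !set_var_id. Qed.

(* Both Ackermann rules: [D] is the set of inequalities bounding [p] on one
   side, and [u] is the extremal value of [p] satisfying it. *)
Lemma Ackermann_sound S p D (bs : seq (ineq L)) I u :
  same_members S (D ++ bs) ->
  ~ occurs_ineq (PVar p) I ->
  (forall v e, List.In e D -> holds (set_var v p (eval v u)) e) ->
  (forall v, (forall e, List.In e D -> holds v e) ->
     forall b, List.In b bs -> holds v b -> holds (set_var v p (eval v u)) b) ->
  valid_system (System S I) <->
  valid_system (System [seq subst_ineq (PVar p) u b | b <- bs] I).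
Proof.
move=> SE pI hD hmono; split=> hval v; rewrite /holds_quasi /= => hS.
  rewrite -(holds_set_var_fresh v (eval v u) pI).
  apply: (hval (set_var v p (eval v u))) => /= e /SE /in_app_iff[]; first exact: hD.
  by move=> eb; rewrite -holds_subst; apply: hS; apply: in_map.
apply: hval => /= e /in_map_iff[b [<- hb]]; rewrite holds_subst.
apply: hmono => //; last by apply: hS; apply/SE/in_app_iff; right.
by move=> e' he'; apply: hS; apply/SE/in_app_iff; left.
Qed.

Lemma pointwise_sound S S' I :
  (forall v : assignment A, (forall e, List.In e S -> holds v e) <->
             (forall e, List.In e S' -> holds v e)) ->
  valid_system (System S I) <-> valid_system (System S' I).
Proof.
by move=> h; split=> hval v hS; apply: hval => e; apply/h: e => e; apply: hS.
Qed.

(** Common form of residuation, with one replacement, and splitting, with two. *)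
Lemma replace_sound S S0 (e : ineq L) es I :
  same_members S (e :: S0) ->
  (forall v : assignment A,
     holds v e <-> (forall e', List.In e' es -> holds v e')) ->
  valid_system (System S I) <-> valid_system (System (es ++ S0) I).
Proof.
move=> SE he; apply: pointwise_sound => v; split=> h e'.
  move=> /in_app_iff[|h0]; last by apply: h; apply/SE; right.
  by apply/he: e'; apply: h; apply/SE; left.
move=> /SE[<-|h0]; last by apply: h; apply/in_app_iff; right.
by apply/he => e'' h''; apply: h; apply/in_app_iff; left.
Qed.

Lemma reduce_sound s s' : reduce s s' -> valid_system s <-> valid_system s'.
Proof.
case.
- move=> S phi gamma psi x k _ slr [fresh _].
  exact: (@approximation_sound plus plus).
- move=> S phi gamma psi x k _ slr [fresh _].
  exact: (@approximation_sound plus minus).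
- move=> S phi psi gamma x k _ slr [fresh _].
  exact: (@approximation_sound minus plus).
- move=> S phi psi gamma x k _ slr [fresh _].
  exact: (@approximation_sound minus minus).
- move=> S S0 e e' I SE _ he; apply: (replace_sound (es := [:: e']) I SE) => v.
  rewrite (residuate_sound v he); split=> [h _ [<-|[]] //|]; apply; by left.
- by move=> S S0 e es I SE _ he; apply: (replace_sound I SE) => v; apply: split_sound.
- move=> S p alphas bs I SE pa pI hb; apply: Ackermann_sound SE pI _ _.
    move=> v e /in_map_iff[a [<- ha]]; rewrite /holds /= eqxx set_var_fresh; last exact: pa.
    by apply: (bigJoin_le v alphas _).1.
  move=> v hD b /hb[bp bn]; rewrite -(holds_set_var_id v p) /holds => h.
  (* The inequalities bounding [p] from below put its value above the join; lowering it to the join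
     shrinks the left-hand sides and enlarges the right-hand sides. *)
  have up : eval v (bigJoin alphas) <= val_var v p.
    apply/bigJoin_le => a ha; apply: (hD (Ineq a (Atom (PVar p)))).
    by apply/in_map_iff; exists a.
  apply: le_trans (eval_positive v bp up) (le_trans h (eval_negative v bn up)).
- move=> S p alphas bs I SE pa pI hb; apply: Ackermann_sound SE pI _ _.
    move=> v e /in_map_iff[a [<- ha]]; rewrite /holds /= eqxx set_var_fresh; last exact: pa.
    by apply: (bigMeet_ge v alphas _).1.
  move=> v hD b /hb[bp bn]; rewrite -(holds_set_var_id v p) /holds => h.
  have up : val_var v p <= eval v (bigMeet alphas).
    apply/bigMeet_ge => a ha; apply: (hD (Ineq (Atom (PVar p)) a)).
    by apply/in_map_iff; exists a.
  apply: le_trans (eval_negative v bp up) (le_trans h (eval_positive v bn up)).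
Qed.

(** * Preprocessing *)

Lemma eliminate_sound e e' : eliminate e e' -> valid A e <-> valid A e'.
Proof.
case=> p {}e _ h1 h2; split=> h v.
- by rewrite holds_subst; apply: h.
(* [\bot] is the hardest value of [p] here: raising [p] lowers the left-hand side and raises the
   right-hand side. *)
- have := h v; rewrite holds_subst -(holds_set_var_id v p) /holds /= => hv.
  have h0 : \bot <= val_var v p by apply: le0x.
  by apply: le_trans (eval_negative v h1 h0) (le_trans hv (eval_positive v h2 h0)).
- by rewrite holds_subst; apply: h.
- have := h v; rewrite holds_subst -(holds_set_var_id v p) /holds /= => hv.
  have h0 : val_var v p <= \top by apply: lex1.
  by apply: le_trans (eval_positive v h1 h0) (le_trans hv (eval_negative v h2 h0)).
Qed.

Lemma distribute_sound (v : assignment A) r t t' :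
  distribute r t t' -> eval v t = eval v t'.
Proof.
elim=> {r t t'} /=; try by move=> *; congruence.
- move=> f i args s t ei argsi; rewrite !(comp_upd (eval v)).
  (* Normality is applied to a two-element list; the empty join or meet ending each fold is then
     absorbed. *)
  have := opF_normal i (fun j => eval v (args j)) [:: eval v s; eval v t].
  by rewrite ei !big_cons !big_nil !joinx0 => <-;
    rewrite -[(_ `|` _)%O]/(eval v (Join s t)) -argsi (upd_id (fun j => eval v (args j))).
- move=> f i args s t ei argsi; rewrite !(comp_upd (eval v)).
  have := opF_normal i (fun j => eval v (args j)) [:: eval v s; eval v t].
  by rewrite ei !big_cons !big_nil !joinx0 !meetx1 => <-;
    rewrite -[(_ `&` _)%O]/(eval v (Meet s t)) -argsi (upd_id (fun j => eval v (args j))).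
- move=> g i args s t ei argsi; rewrite !(comp_upd (eval v)).
  have := opG_normal i (fun j => eval v (args j)) [:: eval v s; eval v t].
  by rewrite ei !big_cons !big_nil !meetx1 => <-;
    rewrite -[(_ `&` _)%O]/(eval v (Meet s t)) -argsi (upd_id (fun j => eval v (args j))).
- move=> g i args s t ei argsi; rewrite !(comp_upd (eval v)).
  have := opG_normal i (fun j => eval v (args j)) [:: eval v s; eval v t].
  by rewrite ei !big_cons !big_nil !joinx0 !meetx1 => <-;
    rewrite -[(_ `|` _)%O]/(eval v (Join s t)) -argsi (upd_id (fun j => eval v (args j))).
- move=> r c i args t _ IH.
  by rewrite (comp_upd (eval v)) -IH (upd_id (fun j => eval v (args j))).
Qed.

Definition all_valid (E : seq (ineq L)) := forall e, List.In e E -> valid A e.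

Lemma all_valid1 e : all_valid [:: e] <-> valid A e.
Proof. by split=> [|h _ [<-|[]] //]; apply; left. Qed.

Lemma distribute_split_sound e es :
  distribute_split e es -> valid A e <-> all_valid es.
Proof.
case=> [s s' t h|s t t' h|{}e {}es h].
- rewrite all_valid1; suff E (v : assignment A) : holds v (Ineq s t) = holds v (Ineq s' t).
    by split=> hv v; move: (hv v); rewrite E.
  by rewrite /holds /= (distribute_sound v h).
- rewrite all_valid1; suff E (v : assignment A) : holds v (Ineq s t) = holds v (Ineq s t').
    by split=> hv v; move: (hv v); rewrite E.
  by rewrite /holds /= (distribute_sound v h).
- split=> [he e' h' v|he v]; first by apply: (split_sound v h).1.
  by apply/(split_sound v h) => e' h'; apply: he.
Qed.

Lemma distribute_split_seq_sound E E' :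
  distribute_split_seq E E' -> all_valid E <-> all_valid E'.
Proof.
case=> E1 E2 e es /distribute_split_sound he; split=> h e' /in_app_iff.
- case=> [h1|/in_app_iff[h1|h1]].
  + by apply: h; apply/in_app_iff; left.
  + by apply: he.1 e' h1; apply: h; apply/in_app_iff; right; left.
  + by apply: h; apply/in_app_iff; right; right.
- case=> [h1|[<-|h1]].
  + by apply: h; apply/in_app_iff; left.
  + by apply/he => e'' h''; apply: h; apply/in_app_iff; right; apply/in_app_iff; left.
  + by apply: h; apply/in_app_iff; right; apply/in_app_iff; right.
Qed.

(** * Complete executions *)

Lemma clos_refl_trans_sound (T : Type) (R : T -> T -> Prop) (P : T -> Prop) :
  (forall x y, R x y -> P x <-> P y) ->
  forall x y, clos_refl_trans T R x y -> P x <-> P y.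
Proof.
move=> hR x y; elim=> [{}x {}y /hR //|//|{}x {}y z _ -> _ -> //].
Qed.

Lemma preprocess_sound e E : preprocess e E -> valid A e <-> all_valid E.
Proof.
case=> e' [he _] [hE _].
rewrite (clos_refl_trans_sound eliminate_sound he) -all_valid1.
exact: clos_refl_trans_sound distribute_split_seq_sound _ _ hE.
Qed.

Lemma valid_initial_system e : valid_system (System [::] e) <-> valid A e.
Proof. by split=> h v; [apply: h | move=> _; apply: h]. Qed.

Lemma ALBA_sound e out : ALBA_output e out -> valid A e <-> valid_conj A out.
Proof.
case=> E hE hout; rewrite (preprocess_sound hE).
(* The quantifiers over assignments and over systems commute, so each system can be followed through
   its own reduction. *)
have -> : valid_conj A out <-> (forall s, List.In s out -> valid_system s).
  by split=> [h s hs v|h v s hs]; apply: h.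
elim: hout => [|e' s E' out' [hs _] _ IH]; first by split=> _ ? [].
have := clos_refl_trans_sound reduce_sound hs.
rewrite valid_initial_system => he.
split=> h s' [<-|hs'].
- by apply/he; apply: h; left.
- by apply: IH.1 s' hs' => e'' h''; apply: h; right.
- by apply/he; apply: h; left.
- by apply: IH.2 s' hs' => e'' h''; apply: h; right.
Qed.

End PerfectLE.

Theorem theorem6p1 (L : LE_language) (d : Order.disp_t) (A : LE L d)
  (phi psi : term L) (out : seq (system L)) :
  perfect A ->
  LE_term phi -> LE_term psi ->
  ALBA_output (Ineq phi psi) out ->
  valid A (Ineq phi psi) <-> valid_conj A out.
Proof. by move=> pA _ _; apply: ALBA_sound. Qed.
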